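(* Let $n\geq 3$. Then $$|\mathcal{AOP}_n|=\begin{cases}\dfrac{n}{2}\dbinom{2n}{n}-\dfrac{n^2(n-1)}{2}+1 & \text{if } n \text{ is odd},\\[2ex] \dfrac{n}{2}\dbinom{2n}{n}-\dfrac{n^2(n-1)+n}{2}+1 & \text{if } n\text{ is even}.\end{cases}$$
   Context: Let $\Omega_n=\{1<2<\cdots<n\}$ and let $\mathcal{I}_n$ be the symmetric inverse monoid on $\Omega_n$, i.e. the monoid of all injective partial maps (partial permutations) of $\Omega_n$ under composition of partial maps. The alternating inverse monoid is $\mathcal{AI}_n=\{\alpha\in\mathcal{I}_n : \alpha=\sigma|_{\mathrm{Dom}(\alpha)}\text{ for some even permutation }\sigma\text{ of }\Omega_n\}$. A partial permutation $\alpha$ with $\mathrm{Dom}(\alpha)=\{a_1<\cdots<a_t\}$, $t\geq 0$, is orientation-preserving if there is at most one index $i\in\{1,\ldots,t\}$ with $a_i\alpha>a_{i+1}\alpha$, where $a_{t+1}$ denotes $a_1$. $\mathcal{AOP}_n$ is the inverse submonoid of $\mathcal{I}_n$ of all orientation-preserving elements of $\mathcal{AI}_n$. *)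

(* Defs.v *)
From mathcomp Require Import all_boot perm.

Set Implicit Arguments.
Unset Strict Implicit.
Unset Printing Implicit Defensive.

Section PartialPermutations.

Variable n : nat.

(* Omega_n is 'I_n, so points are numbered from 0; a partial map is undefined
   at the points sent to None. *)
Definition pmapping := {ffun 'I_n -> option 'I_n}.

Implicit Types (a : pmapping) (s : 'S_n) (D : {set 'I_n}).

Definition pdom a : {set 'I_n} := [set i | a i != None].

Definition sym_inv_monoid : {set pmapping} :=
  [set a : pmapping | [forall i in pdom a, forall j in pdom a,
                         (a i == a j) ==> (i == j)]].

Definition perm_restr s D : pmapping :=
  [ffun i => if i \in D then Some (s i) else None].

Definition alt_inv_monoid : {set pmapping} :=
  [set a in sym_inv_monoid |
    [exists s : 'S_n, ~~ odd_perm s && (a == perm_restr s (pdom a))]].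

Definition pgt (x y : option 'I_n) : bool :=
  if (x, y) is (Some u, Some v) then v < u else false.

(* [enum_val] lists the points of [pdom a] in increasing order, and [ordS] is
   the cyclic successor on the indices. *)
Definition cyclic_descents a : {set 'I_#|pdom a|} :=
  [set i | pgt (a (enum_val i)) (a (enum_val (ordS i)))].

Definition orientation_preserving a : bool := #|cyclic_descents a| <= 1.

Definition AOP : {set pmapping} :=
  [set a in alt_inv_monoid | orientation_preserving a].

Lemma enum_val_pdom_mono a :
  {mono (fun i : 'I_#|pdom a| => val (enum_val i)) : i j / i < j}.
Proof.
have srt : sorted ltn (map val (enum (pdom a))).
  rewrite sorted_map {1}/enum_mem -enumT; apply: sorted_filter.
    by move=> x y z; apply: ltn_trans.
  by rewrite -sorted_map val_enum_ord iota_ltn_sorted.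
have homo (i j : 'I_#|pdom a|) : i < j -> val (enum_val i) < val (enum_val j).
  move=> ltij; have si (k : 'I_#|pdom a|) : k < size (enum (pdom a)).
    by rewrite -cardE.
  have x0 := enum_val i.
  rewrite !(enum_val_nth x0) -!(nth_map x0 0 val) //.
  by apply: (sorted_ltn_nth ltn_trans 0 srt); rewrite ?inE ?size_map.
move=> i j; apply/idP/idP; last exact: homo.
case: (ltngtP i j) => [//|/homo/ltnW|/val_inj->]; last by rewrite ltnn.
by rewrite leqNgt => /negbTE->.
Qed.

End PartialPermutations.

(* Main.v *)
(* An orientation-preserving partial permutation of rank k >= 1 is determined by
   its domain D, its image E and a rotation index r < k, so there are
   k * C(n, k)^2 of them.  If k <= n - 2, composing an extension to Omega_n with
   a transposition of two points outside E changes its sign, so all of them are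
   alternating.  If k >= n - 1, the extension is unique, and in all cases but
   one exactly half of the extensions are even: replacing r by r + 1 composes
   with a k-cycle, which is odd when k is even, and when n is even and k = n - 1
   replacing the missing point 2m of E by 2m + 1 (and conversely) composes with
   a transposition.  The exception is k = n odd, where all rotations are even.
   The sum of k * C(n, k)^2 is (n / 2) * C(2n, n), by the symmetry k <-> n - k
   and Vandermonde's identity. *)
Require Import Defs.
From mathcomp Require Import all_boot all_order all_algebra all_fingroup.
From mathcomp Require Import zify lra.

Set Implicit Arguments.
Unset Strict Implicit.
Unset Printing Implicit Defensive.

Import Order.TTheory GRing.Theory Num.Theory.

(** * Rotations of sequences, read through indices modulo the length *)

Lemma modn_lt_double k x : x < k + k -> x %% k = if x < k then x else x - k.
Proof.
case: (ltnP x k) => [ltxk _|lekx ltx]; first by rewrite modn_small.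
by rewrite -{1}(subnK lekx) modnDr modn_small //; lia.
Qed.

Lemma nth_rot (T : Type) (x0 : T) (s : seq T) r i :
  r <= size s -> i < size s ->
  nth x0 (rot r s) i = nth x0 s ((i + r) %% size s).
Proof.
move=> ler lti; rewrite /rot nth_cat size_drop modn_lt_double; last by lia.
case: ifP => h1; case: ifP => h2; try lia.
  by rewrite nth_drop addnC.
by rewrite nth_take; [congr nth|]; lia.
Qed.

Lemma rot_inj_uniq (T : eqType) (s : seq T) i j :
  uniq s -> i < size s -> j < size s -> rot i s = rot j s -> i = j.
Proof.
case: s => // x0 s us lti ltj /(congr1 (nth x0 ^~ 0)).
rewrite !nth_rot //; try exact: ltnW.
by rewrite !add0n !modn_small // => /eqP; rewrite nth_uniq // => /eqP.
Qed.

(** * Cyclic descents of sequences and rotations of increasing sequences *)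

Section Sequences.

Variable n : nat.
Implicit Types (s t : seq 'I_n) (D E : {set 'I_n}).

Let ltI (i j : 'I_n) := i < j.

Let ltI_trans : transitive ltI. Proof. by move=> x y z; apply: ltn_trans. Qed.

Lemma enum_set_sorted E : sorted (fun i j : 'I_n => i < j) (enum E).
Proof.
rewrite {1}/enum_mem -enumT; apply: sorted_filter => //.
by have := iota_ltn_sorted 0 n; rewrite -val_enum_ord sorted_map.
Qed.

Lemma sorted_enum_set s E :
  sorted (fun i j : 'I_n => i < j) s -> s =i E -> s = enum E.
Proof.
move=> sort_s sE; apply: (@irr_sorted_eq _ ltI) => //.
- by move=> x; rewrite /ltI ltnn.
- exact: enum_set_sorted.
- by move=> x; rewrite mem_enum.
Qed.

(** The successor of the last index wraps around to 0. The bound on [i] excludes spurious descents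
    past the end, and the head [x0] only serves as default value of [nth]. *)
Definition descent s (i : nat) : bool :=
  (i < size s) &&
  if s is x0 :: _ then nth x0 s (i.+1 %% size s) < nth x0 s i else false.

Lemma descentE x0 s i :
  i < size s -> descent s i = (nth x0 s (i.+1 %% size s) < nth x0 s i).
Proof.
rewrite /descent; case: s => // y s lti; rewrite lti /=.
by rewrite !(set_nth_default x0 y) // ltn_mod.
Qed.

(** A rotated increasing sequence can only descend where the last entry of [s] is followed
    cyclically by the first, and that happens at a single index. *)
Lemma sorted_rot_descent s r i j :
    sorted (fun i j : 'I_n => i < j) s -> r < size s ->
  descent (rot r s) i -> descent (rot r s) j -> i = j.
Proof.
move=> srt ltr di dj.
have [lti _] := andP di; have [ltj _] := andP dj.
rewrite !size_rot in lti ltj.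
have x0 : 'I_n by case: (s) ltr => //.
suff last_desc l : l < size s -> descent (rot r s) l ->
    (l + r) %% size s = (size s).-1.
  have := last_desc _ lti di; have := last_desc _ ltj dj.
  by rewrite !modn_lt_double; try lia; do 2 case: ifP; lia.
move=> ltl; rewrite (descentE x0) ?size_rot // !nth_rot; try lia.
have -> : (l.+1 %% size s + r) %% size s = ((l + r) %% size s).+1 %% size s.
  by rewrite modnDml -[in RHS]addn1 modnDml addn1 addSn.
set m := (l + r) %% size s => hd.
have ltm : m < size s by rewrite ltn_mod; lia.
case: (ltnP m (size s).-1) => [ltm1|]; last by lia.
have ltm2 : m.+1 < size s by lia.
move: hd; rewrite modn_small // => hd.
have := elimT (sortedP x0) srt m ltm2.
by move=> /(ltn_trans hd); rewrite ltnn.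
Qed.

(** Rotating [s] so that it starts just after its descent leaves no descent inside, so the result is
    increasing and must be the enumeration of its entries. The rotation is then undone. *)
Lemma unique_descent_rot s : uniq s -> 0 < size s ->
    (forall i j, descent s i -> descent s j -> i = j) ->
  exists2 r, r < size s & s = rot r (enum [set x in s]).
Proof.
move=> us s_gt0 uniq_d.
have x0 : 'I_n by case: (s) s_gt0 => //.
suff [r ltr srt] : exists2 r, r < size s &
    sorted (fun i j : 'I_n => i < j) (rot r s).
  have e : rot r s = enum [set x in s].
    by apply: sorted_enum_set => // x; rewrite mem_rot inE.
  have sz : size (enum [set x in s]) = size s by rewrite -e size_rot.
  rewrite -{2}(rotK r s) e /rotr sz.
  (* The inverse of rotation by [r] is rotation by [size s - r], which is out of range when [r] is
     0. *)
  case: (posnP r) => [r0|r_gt0]; last by exists (size s - r) => //; lia.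
  by exists 0 => //; rewrite r0 subn0 rot0 -sz rot_size.
have lt_next r i : r < size s -> i.+1 < size s ->
    ~~ descent s ((i + r) %% size s) ->
    nth x0 (rot r s) i < nth x0 (rot r s) i.+1.
  move=> ltr lti; rewrite (descentE x0) ?ltn_mod // -leqNgt.
  rewrite !nth_rot; try lia.
  have -> : ((i + r) %% size s).+1 %% size s = (i.+1 + r) %% size s.
    by rewrite -addn1 modnDml addn1 addSn.
  rewrite leq_eqVlt => /orP[/eqP/val_inj/eqP|//].
  rewrite nth_uniq ?ltn_mod // !modn_lt_double; try lia.
  by do 2 case: ifP; lia.
have [/hasP[d _ dd]|/hasPn nod] := boolP (has (descent s) (iota 0 (size s))).
  have [ltd _] := andP dd.
  exists (d.+1 %% size s); first by rewrite ltn_mod.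
  apply/(sortedP x0) => i; rewrite size_rot => lti.
  apply: lt_next; rewrite ?ltn_mod //.
  apply/negP => /uniq_d/(_ dd); rewrite modnDmr addnS -addSn.
  by rewrite modn_lt_double; try lia; case: ifP; lia.
exists 0 => //; apply/(sortedP x0) => i; rewrite size_rot => lti.
apply: lt_next => //; apply: nod.
by rewrite mem_iota addn0 modn_small; lia.
Qed.

(** * Extension to permutations and signs of rotations *)

(** Appending the missing points turns [s] and [t] into two listings of all of ['I_n], which are
    matched position by position. *)
Lemma uniq_seqs_perm s t : uniq s -> uniq t -> size s = size t ->
  exists p : 'S_n, map p s = t.
Proof.
move=> us ut est.
pose s' := s ++ enum (~: [set x in s]); pose t' := t ++ enum (~: [set x in t]).
have full (r : seq (ordinal n)) : uniq r ->
    let r' := r ++ enum (~: [set x in r]) in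
    [/\ uniq r', size r' = n & forall x, x \in r'].
  move=> ur r'; have mem_r' x : x \in r'.
    by rewrite mem_cat mem_enum !inE orbN.
  have ur' : uniq r'.
    rewrite cat_uniq ur enum_uniq andbT; apply/hasPn => x.
    by rewrite mem_enum !inE.
  split => //.
  by rewrite -(card_uniqP ur') (eq_card (B := 'I_n)) ?card_ord.
have [us' ss' ms'] := full s us; have [ut' st' mt'] := full t ut.
pose f x := nth x t' (index x s').
have lti x : index x s' < size t' by move: (ms' x); rewrite -index_mem ss' st'.
have inj_f : injective f.
  move=> x y; rewrite /f (set_nth_default y) // => /eqP.
  by rewrite nth_uniq // => /eqP/index_inj; apply.
exists (perm inj_f).
case es : s => [|x0 s1]; first by move: est; rewrite es; case: (t).
rewrite -es; apply: (@eq_from_nth _ x0); rewrite size_map // => i lti_s.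
rewrite (nth_map x0) // permE /f index_cat mem_nth // index_uniq //.
by rewrite nth_cat -est lti_s; apply: set_nth_default; rewrite -est.
Qed.

(** The cycle is built as a product of transpositions, one for each entry of [s]. The last clause
    carries the induction: the shorter cycle must fix the new point [y]. *)
Lemma rot1_perm x s : uniq (x :: s) ->
  exists p : 'S_n, [/\ odd_perm p = odd (size s), map p (x :: s) = rcons s x
                     & forall z, z \notin x :: s -> p z = z].
Proof.
elim: s => [|y s IH].
  by exists 1%g; split=> [||z _]; rewrite ?odd_perm1 //= perm1.
rewrite [uniq _]/= inE negb_or => /andP[/andP[nxy nxs] /andP[nys us]].
have [|p [op mp fp]] := IH; first by rewrite /= nxs.
have py : p y = y by apply: fp; rewrite inE negb_or eq_sym nxy.
exists (tperm x y * p)%g; split.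
- by rewrite odd_permM odd_tperm nxy op.
- move: mp => /= mp; rewrite !permM tpermL tpermR py -mp; congr [:: _, _ & _].
  apply/eq_in_map => z zs; rewrite permM tpermD //.
    by apply: contraNneq nxs => ->.
  by apply: contraNneq nys => ->.
- move=> z; rewrite !inE !negb_or => /and3P[zx zy zs].
  by rewrite permM tpermD 1?eq_sym // fp // inE negb_or zx.
Qed.

Lemma rot_perm s r : uniq s -> r <= size s ->
  exists2 p : 'S_n, odd_perm p = odd (r * (size s).-1) & map p s = rot r s.
Proof.
move=> us; elim: r => [|r IH] ler.
  exists 1%g; rewrite ?odd_perm1 ?rot0 // map_id_in // => x _.
  by rewrite perm1.
have [p op mp] := IH (ltnW ler).
have : uniq (rot r s) by rewrite rot_uniq.
rewrite rotS //; case e : (rot r s) => [|x t].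
  by move: ler; rewrite -(size_rot r s) e.
move=> /rot1_perm[q [oq mq _]]; exists (p * q)%g.
  by rewrite odd_permM op oq mulSn oddD addbC -(size_rot r s) e.
rewrite rot1_cons -mq -e -mp -map_comp; apply: eq_map => z.
by rewrite permM.
Qed.

End Sequences.

(** * Partial permutations as sequences of values along their domains *)

Section Counting.

Variable n : nat.
Implicit Types (s t : seq 'I_n) (D E : {set 'I_n}) (a : pmapping n).

(** The points of [D], in increasing order, are sent to the successive entries of [s]; the default
    [i] is reached only if [s] is too short. *)
Definition seq_pmap D s : pmapping n :=
  [ffun i => if i \in D then Some (nth i s (index i (enum D))) else None].

Lemma pdom_seq_pmap D s : pdom (seq_pmap D s) = D.
Proof. by apply/setP => i; rewrite inE ffunE; case: (i \in D). Qed.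

Lemma map_seq_pmap D s : size s = #|D| ->
  map (seq_pmap D s) (enum D) = map Some s.
Proof.
rewrite cardE => sz.
case es : s => [|x0 t]; first by move: sz; rewrite es; case: (enum D).
rewrite -es; apply: (@eq_from_nth _ None); rewrite !size_map // => i lti.
have lti' : i < size s by rewrite sz.
rewrite !(nth_map x0) // ffunE -mem_enum mem_nth // index_uniq ?enum_uniq //.
by congr Some; apply: set_nth_default.
Qed.

Lemma eq_seq_pmap a s :
  map a (enum (pdom a)) = map Some s -> a = seq_pmap (pdom a) s.
Proof.
move=> e; apply/ffunP => i; rewrite ffunE; case: ifP => [ia|]; last first.
  by rewrite inE => /negbFE/eqP.
have sz : size (enum (pdom a)) = size s by rewrite -(size_map a) e size_map.
have lti : index i (enum (pdom a)) < size (enum (pdom a)).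
  by rewrite index_mem mem_enum.
by rewrite -(nth_map i None) -?sz // -e (nth_map i) // nth_index // mem_enum.
Qed.

Lemma pmap_seq a :
  exists2 s, size s = #|pdom a| & map a (enum (pdom a)) = map Some s.
Proof.
exists [seq odflt i (a i) | i <- enum (pdom a)].
  by rewrite size_map -cardE.
rewrite -map_comp; apply/eq_in_map => i; rewrite mem_enum inE /=.
by case: (a i).
Qed.

(** This lemma and the next two translate the conditions defining [AOP] into conditions on the value
    sequence [s]. *)
Lemma sym_inv_seqE a s : map a (enum (pdom a)) = map Some s ->
  (a \in sym_inv_monoid n) = uniq s.
Proof.
move=> e; have -> : uniq s = uniq (map a (enum (pdom a))).
  by rewrite e map_inj_uniq // => x y [].
rewrite inE; apply/forall_inP/idP => [inj_a|].
  rewrite map_inj_in_uniq ?enum_uniq // => i j.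
  rewrite !mem_enum => ia ja /eqP aij.
  by apply/eqP; move/forall_inP: (inj_a i ia) => /(_ j ja)/implyP; apply.
move=> ua i ia; apply/forall_inP => j ja; apply/implyP => /eqP aij.
have lti k : k \in pdom a -> index k (enum (pdom a)) < size (enum (pdom a)).
  by rewrite index_mem mem_enum.
have := nth_uniq None _ _ ua; rewrite size_map.
move=> /(_ _ _ (lti i ia) (lti j ja)).
rewrite !(nth_map i) ?lti // !nth_index ?mem_enum // aij eqxx => /esym/eqP.
by move/index_inj => -> //; rewrite mem_enum.
Qed.

Lemma orientation_preserving_seqP a s : map a (enum (pdom a)) = map Some s ->
  reflect (forall i j, descent s i -> descent s j -> i = j)
          (orientation_preserving a).
Proof.
move=> e; have sz : size s = #|pdom a|.
  by rewrite -(size_map Some) -e size_map -cardE.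
have desc (i : 'I_#|pdom a|) : (i \in cyclic_descents a) = descent s i.
  have x0 := enum_val i.
  have av (j : 'I_#|pdom a|) : a (enum_val j) = Some (nth x0 s j).
    rewrite (enum_val_nth x0) -(nth_map x0 None) -?cardE //.
    by rewrite e (nth_map x0) // sz.
  by rewrite inE /= !av /pgt (descentE x0) ?sz.
apply: (iffP card_le1_eqP) => [uniq_d i j di dj|uniq_d i j di dj].
  have [lti _] := andP di; have [ltj _] := andP dj.
  rewrite sz in lti ltj.
  suff [] : Ordinal ltj = Ordinal lti by [].
  by apply: uniq_d; rewrite desc.
by apply/val_inj/uniq_d; rewrite -desc.
Qed.

Lemma alt_inv_seqP a s : a \in sym_inv_monoid n ->
    map a (enum (pdom a)) = map Some s ->
  reflect (exists2 p : 'S_n, ~~ odd_perm p & map p (enum (pdom a)) = s)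
          (a \in alt_inv_monoid n).
Proof.
move=> ai e; rewrite inE ai /=; apply: (iffP existsP).
  move=> [p /andP[op /eqP ap]]; exists p => //.
  apply: (@inj_map _ _ Some) => [x y []//|]; rewrite -e -map_comp.
  apply/eq_in_map => i; rewrite mem_enum => ia.
  by rewrite [in RHS]ap ffunE ia.
move=> [p op mp]; exists p; rewrite op /=; apply/eqP/ffunP => i; rewrite ffunE.
case: ifP => [ia|]; last by rewrite inE => /negbFE/eqP.
have /eq_in_map : map a (enum (pdom a)) = map (Some \o p) (enum (pdom a)).
  by rewrite e -mp map_comp.
by apply; rewrite mem_enum.
Qed.

(** * Coding of orientation-preserving maps by domain, image and rotation *)

Local Notation triple k := ({set 'I_n} * {set 'I_n} * 'I_k)%type.

Definition rank_part k : {set pmapping n} := [set a in AOP n | #|pdom a| == k].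

(* A triple [(D, E, r)] codes the orientation-preserving partial permutation
   with domain [D] and image [E] sending the least point of [D] to the [r]-th
   point of [E], counting from 0. *)
Definition triples k : {set triple k} :=
  [set u : triple k | (#|u.1.1| == k) && (#|u.1.2| == k)].

(** A predicate rather than a sign function, since a partial permutation may have extensions of both
    parities. *)
Definition has_parity b k (u : triple k) : bool :=
  [exists p : 'S_n,
     (odd_perm p == b) && (map p (enum u.1.1) == rot u.2 (enum u.1.2))].

Definition triple_pmap k (u : triple k) : pmapping n :=
  seq_pmap u.1.1 (rot u.2 (enum u.1.2)).

(** [triple_pmap] is a bijection from the triples with an even extension. The rank is positive
    because the empty map has no rotation index in ['I_0]. *)
Lemma card_rank_part k :
  #|rank_part k.+1| = #|[set u in triples k.+1 | has_parity false u]|.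
Proof.
have -> : rank_part k.+1 =
    (@triple_pmap k.+1) @: [set u in triples k.+1 | has_parity false u].
  apply/setP => a; apply/idP/imsetP => [|[[[D E] r]]].
    rewrite inE [a \in AOP n]inE => /andP[/andP[alta opa] /eqP cda].
    have ai : a \in sym_inv_monoid n by move: alta; rewrite inE => /andP[].
    have [s sz e] := pmap_seq a.
    have us : uniq s by rewrite -(sym_inv_seqE e).
    have uniq_d := elimT (orientation_preserving_seqP e) opa.
    have [|r ltr sr] := unique_descent_rot us _ uniq_d.
      by rewrite sz cda.
    have ltr' : r < k.+1 by rewrite -cda -sz.
    exists (pdom a, [set x in s], Ordinal ltr'); last first.
      by rewrite /triple_pmap /= -sr; apply: eq_seq_pmap.
    have cs : #|[set x in s]| = k.+1 by rewrite cardsE (card_uniqP us) sz.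
    rewrite inE inE /= cda cs eqxx /=.
    have [p op mp] := elimT (alt_inv_seqP ai e) alta.
    by apply/existsP; exists p; rewrite /= mp -sr eqxx (negbTE op).
  rewrite inE [_ \in triples _]inE /=.
  move=> /andP[/andP[/eqP cD /eqP cE] /existsP[p /andP[/eqP op /eqP mp]]] ->.
  rewrite inE [_ \in AOP n]inE.
  rewrite /triple_pmap /= in mp *.
  set s := rot r (enum E) in mp *.
  have us : uniq s by rewrite rot_uniq enum_uniq.
  have sz : size s = #|D| by rewrite size_rot -cardE cE.
  have e := map_seq_pmap sz.
  rewrite -{2}(pdom_seq_pmap D s) in e.
  have ai : seq_pmap D s \in sym_inv_monoid n by rewrite (sym_inv_seqE e).
  rewrite pdom_seq_pmap cD eqxx andbT; apply/andP; split.
    by apply/(alt_inv_seqP ai e); exists p; rewrite ?op // pdom_seq_pmap.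
  apply/(orientation_preserving_seqP e) => i j.
  by apply: sorted_rot_descent; rewrite ?enum_set_sorted // -cardE cE.
rewrite card_in_imset // => -[[D E] r] [[D' E'] r'].
rewrite !inE /= => /andP[/andP[/eqP cD /eqP cE] _].
move=> /andP[/andP[/eqP cD' /eqP cE'] _].
rewrite /triple_pmap /= => eq_map.
(* The map determines its domain [D], then the rotated list of values, whose entries form [E]; the
   first entry fixes [r]. *)
have eD : D = D'.
  by rewrite -(pdom_seq_pmap D (rot r (enum E))) eq_map pdom_seq_pmap.
rewrite -eD in cD' eq_map *.
have := map_seq_pmap (D := D) (s := rot r (enum E)).
rewrite size_rot -cardE eq_map map_seq_pmap ?size_rot -?cardE ?cE ?cE' // cD.
move=> /(_ erefl)/(inj_map (@Some_inj _)) err.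
have eE : E = E'.
  by apply/setP => x; rewrite -[LHS]mem_enum -(mem_rot r) -err mem_rot mem_enum.
rewrite -eE in err *; congr (_, _, _); apply/val_inj/esym.
by apply: (rot_inj_uniq (enum_uniq E)) err; rewrite -cardE cE.
Qed.

Lemma card_triples k : #|triples k| = 'C(n, k) ^ 2 * k.
Proof.
have -> : triples k = setX (setX [set A : {set 'I_n} | #|A| == k]
                                 [set A : {set 'I_n} | #|A| == k]) setT.
  by apply/setP => -[[D E] r]; rewrite !inE andbT.
by rewrite !cardsX cardsT card_draws !card_ord.
Qed.


(** * Parities of the extensions according to the rank *)

Lemma has_parity_ex k u : u \in triples k -> exists b, has_parity b u.
Proof.
rewrite inE => /andP[/eqP cD /eqP cE].
have [||| p mp] := @uniq_seqs_perm n (enum u.1.1) (rot u.2 (enum u.1.2)).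
- exact: enum_uniq.
- by rewrite rot_uniq enum_uniq.
- by rewrite size_rot -!cardE cD cE.
by exists (odd_perm p); apply/existsP; exists p; rewrite mp !eqxx.
Qed.

Lemma has_parity_small k u b : k.+2 <= n -> u \in triples k -> has_parity b u.
Proof.
move=> lek uT; have [b' /existsP[p /andP[/eqP op /eqP mp]]] := has_parity_ex uT.
move: uT; rewrite inE => /andP[_ /eqP cE].
have [eb|neb] := eqVneq b b'.
  by apply/existsP; exists p; rewrite op eb mp !eqxx.
have : 1 < #|~: u.1.2| by have := cardsC u.1.2; rewrite card_ord cE; lia.
case/card_gt1P => x [y [xE yE nxy]]; rewrite !inE in xE yE.
apply/existsP; exists (p * tperm x y)%g.
rewrite odd_permM op odd_tperm nxy addbT; apply/andP; split.
  by case: (b) neb => //; case: (b').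
rewrite -mp; apply/eqP/eq_in_map => z zD; rewrite permM.
have : p z \in u.1.2 by rewrite -mem_enum -(mem_rot u.2) -mp map_f.
move=> pzE; rewrite tpermD //.
  by apply: contraNneq xE => ->.
by apply: contraNneq yE => ->.
Qed.

(** Two extensions agree on the domain, which misses at most one point, so they coincide and only
    one parity occurs. *)
Lemma has_parity_big k u : n <= k.+1 -> u \in triples k ->
  has_parity true u = ~~ has_parity false u.
Proof.
move=> lek uT; have [b' pb'] := has_parity_ex uT.
suff excl : ~~ (has_parity true u && has_parity false u).
  by case: b' pb' excl => ->; rewrite ?andbT // => /negbTE->.
apply/negP => /andP[/existsP[p /andP[/eqP op /eqP mp]]].
move=> /existsP[q /andP[/eqP oq /eqP mq]].
suff pq : p = q by rewrite pq oq in op.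
have agree x : x \in u.1.1 -> p x = q x.
  move=> xD; have /eq_in_map := etrans mp (esym mq); apply.
  by rewrite mem_enum.
have : #|~: u.1.1| <= 1.
  move: uT; rewrite inE => /andP[/eqP cD _].
  by have := cardsC u.1.1; rewrite card_ord cD; lia.
move=> /card_le1_eqP le1; apply/permP => x.
have [/agree//|xD] := boolP (x \in u.1.1).
(* If [q] sent a point of the domain to [p x], then so would [p], against injectivity; so the
   preimage of [p x] under [q] is also outside the domain and equals [x]. *)
suff zx : (q^-1)%g (p x) = x by rewrite -{2}zx permKV.
apply: le1; rewrite inE //.
apply: contra xD => zD; have := agree _ zD; rewrite permKV => /perm_inj zx.
by rewrite -zx.
Qed.

(** The map [f] sends each of the two parts injectively into the other, so their sizes agree; it
    need not be an involution. *)
Lemma card_half (T : finType) (A : {set T}) (P : pred T) (f : T -> T) :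
    {in A &, injective f} -> {in A, forall u, f u \in A} ->
    {in A, forall u, P (f u) = ~~ P u} ->
  2 * #|[set u in A | P u]| = #|A|.
Proof.
move=> inj_f stab flip.
have le (Q : pred T) (R : pred T) : {in A, forall u, Q u -> R (f u)} ->
    #|[set u in A | Q u]| <= #|[set u in A | R u]|.
  move=> QR; rewrite -(card_in_imset (f := f) (D := [set u in A | Q u])).
    apply/subset_leq_card/subsetP => _ /imsetP[u + ->]; rewrite !inE.
    by move=> /andP[uA Qu]; rewrite stab // QR.
  by move=> u v; rewrite !inE => /andP[uA _] /andP[vA _]; apply: inj_f.
rewrite -(cardsID [set u | P u] A) mulSn mul1n.
have -> : A :&: [set u | P u] = [set u in A | P u].
  by apply/setP => u; rewrite !inE.
have -> : A :\: [set u | P u] = [set u in A | ~~ P u].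
  by apply/setP => u; rewrite !inE andbC.
congr (_ + _); apply/eqP; rewrite eqn_leq !le // => u uA; rewrite flip //.
by rewrite negbK.
Qed.

Lemma card_even_triples k (f : triple k -> triple k) :
    n <= k.+1 -> injective f -> {in triples k, forall u, f u \in triples k} ->
    (forall u b, u \in triples k -> has_parity b u ->
       has_parity (~~ b) (f u)) ->
  2 * #|[set u in triples k | has_parity false u]| = 'C(n, k) ^ 2 * k.
Proof.
move=> lek inj_f stab flip; rewrite -card_triples.
apply: (card_half (f := f)) => //.
  by move=> u v _ _; apply: inj_f.
move=> u uT; have [b ub] := has_parity_ex uT.
have := has_parity_big lek uT; have := has_parity_big lek (stab u uT).
have := flip u b uT ub; case: b ub => /= -> -> // /esym/negbTE -> //.
Qed.

Definition rotate_triple k (u : triple k) := (u.1, ordS u.2).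

(** One more rotation step composes the extension with a cycle of length [k.+1], whose sign has the
    parity of [k]. *)
Lemma has_parity_rotate k u b : u \in triples k.+1 -> has_parity b u ->
  has_parity (b (+) odd k) (rotate_triple u).
Proof.
rewrite inE => /andP[_ /eqP cE] /existsP[p /andP[/eqP op /eqP mp]].
have sz : size (rot u.2 (enum u.1.2)) = k.+1 by rewrite size_rot -cardE.
have [||q oq mq] := @rot_perm n (rot u.2 (enum u.1.2)) 1.
- by rewrite rot_uniq enum_uniq.
- by rewrite sz.
apply/existsP; exists (p * q)%g; rewrite odd_permM op oq sz mul1n eqxx /=.
apply/eqP; transitivity (map q (map p (enum u.1.1))).
  by rewrite -map_comp; apply: eq_map => x; rewrite permM.
rewrite mp mq; case: (u) cE => -[D E] r /= cE.
have {}cE : size (enum E) = k.+1 by rewrite -cardE.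
(* At the last index [ordS] returns to 0, in accordance with the full rotation being the
   identity. *)
have := ltn_ord r; rewrite leq_eqVlt eqSS => /predU1P[->|ltr].
  by rewrite modnn rot0 -rotS ?cE // -cE rot_size.
by rewrite modn_small // -rotS // cE ltnW.
Qed.

Lemma card_even_rotate k : n <= k.+2 -> odd k ->
  2 * #|[set u in triples k.+1 | has_parity false u]| = 'C(n, k.+1) ^ 2 * k.+1.
Proof.
move=> lek ok; apply: (card_even_triples (f := @rotate_triple k.+1)) => //.
- move=> [[D E] r] [[D' E'] r'] [-> ->] e.
  by congr (_, _, _); apply: ordS_inj; apply: val_inj.
- by move=> u; rewrite !inE.
by move=> u b uT /(has_parity_rotate uT); rewrite ok addbT.
Qed.

(** Domain and image are everything, so the map is a power of an [n]-cycle, which is even for odd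
    [n]. *)
Lemma has_parity_full u : odd n -> u \in triples n -> has_parity false u.
Proof.
move=> on; rewrite inE => /andP[/eqP cD /eqP cE].
have full (A : {set 'I_n}) : #|A| = n -> A = setT.
  by move=> cA; apply/eqP; rewrite eqEcard subsetT cardsT card_ord cA leqnn.
rewrite /has_parity (full _ cD) (full _ cE).
have [||q oq mq] := @rot_perm n (enum [set: 'I_n]) u.2.
- exact: enum_uniq.
- by rewrite -cardE cardsT card_ord ltnW.
apply/existsP; exists q; rewrite oq mq eqxx andbT -cardE cardsT card_ord.
by have -> : odd (u.2 * n.-1) = false by rewrite oddM; lia.
Qed.

(** * Rank [n - 1] for even [n]: moving the missing point of the image *)

Section EvenCodimensionOne.

Hypothesis even_n : ~~ odd n.

Lemma toggle_lt (i : 'I_n) : (if odd i then i.-1 else i.+1) < n.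
Proof. by have := ltn_ord i; have := even_n; case: ifP; lia. Qed.

(** Exchanges [2m] and [2m + 1]; evenness of [n] ensures that every point has a partner. *)
Definition toggle (i : 'I_n) : 'I_n := Ordinal (toggle_lt i).

Lemma toggleK : involutive toggle.
Proof. by move=> i; apply/val_inj => /=; case: ifP; case: ifP; lia. Qed.

Lemma toggle_preimset (i : 'I_n) :
  toggle @^-1: (~: [set i]) = ~: [set toggle i].
Proof. by apply/setP => x; rewrite !inE (can2_eq toggleK toggleK). Qed.

(** As [i] and [toggle i] are adjacent, their transposition preserves the order on the complement of
    [i]. Hence it maps one enumeration to the other without reordering. *)
Lemma enum_toggle (i : 'I_n) :
  enum (~: [set toggle i]) = map (tperm i (toggle i)) (enum (~: [set i])).
Proof.
symmetry; apply: sorted_enum_set; last first.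
  move=> x; rewrite -(tpermK i (toggle i) x) mem_map; last exact: perm_inj.
  rewrite mem_enum !inE tpermK; congr (~~ _).
  by rewrite -(inj_eq (@perm_inj _ (tperm i (toggle i)))) tpermK tpermL.
rewrite sorted_map.
apply: (@sub_in_sorted _ (mem (~: [set i])) (fun x y : 'I_n => x < y));
  last exact: enum_set_sorted.
  move=> x y; rewrite !inE => xi yi ltxy /=.
  have {}xi : x != i :> nat by [].
  have {}yi : y != i :> nat by [].
  have tv (z : ordinal n) : z != i :> nat ->
      tperm i (toggle i) z = (if z == toggle i then i else z) :> nat.
    move=> zi; case: eqVneq => [->|zt]; first by rewrite tpermR.
    by rewrite tpermD // eq_sym.
  rewrite !tv // -!val_eqE /=; do !case: ifP; lia.
by apply/allP => x; rewrite mem_enum.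
Qed.

Definition toggle_triple k (u : triple k) :=
  (u.1.1, toggle @^-1: u.1.2, u.2).

Lemma card_even_toggle k : n = k.+1 ->
  2 * #|[set u in triples k | has_parity false u]| = 'C(n, k) ^ 2 * k.
Proof.
move=> nk; apply: (card_even_triples (f := @toggle_triple k)).
- by rewrite nk.
- move=> [[D E] r] [[D' E'] r'] [-> e ->]; congr (_, _, _); apply/setP => x.
  by move/setP/(_ (toggle x)): e; rewrite !inE toggleK.
- move=> [[D E] r]; rewrite !inE /= => /andP[-> /eqP <-] /=.
  by rewrite on_card_preimset //; exists toggle => x _; rewrite toggleK.
move=> [[D E] r] b; rewrite inE /= => /andP[_ /eqP cE].
move=> /existsP[p /andP[/eqP op /eqP /= mp]].
(* The image misses exactly one point [i], and exchanging [i] with its distinct partner is an odd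
   permutation. *)
have /cards1P[i Ei] : #|~: E| == 1.
  by apply/eqP; have := cardsC E; rewrite card_ord cE; lia.
have {}Ei : E = ~: [set i] by rewrite -Ei setCK.
apply/existsP; exists (p * tperm i (toggle i))%g.
have neq : i != toggle i by rewrite -val_eqE /=; case: ifP; lia.
rewrite odd_permM op odd_tperm neq addbT eqxx /= Ei toggle_preimset enum_toggle.
rewrite -map_rot -Ei -mp -map_comp; apply/eqP/eq_map => x.
by rewrite permM.
Qed.

End EvenCodimensionOne.

(** * Sizes of the ranks and their sum *)

Lemma card_rank_part0 : #|rank_part 0| = 1.
Proof.
have -> : rank_part 0 = [set seq_pmap set0 [::]]; last by rewrite cards1.
apply/setP => a; rewrite !inE cards_eq0; apply/andP/eqP => [[_ /eqP a0]|->].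
  by rewrite -a0; apply: eq_seq_pmap; rewrite a0 enum_set0.
have e : map (seq_pmap set0 [::]) (enum (pdom (seq_pmap set0 [::]))) =
    map Some [::].
  by rewrite pdom_seq_pmap enum_set0.
have := sym_inv_seqE e; rewrite inE /= pdom_seq_pmap => ai.
rewrite ai; split=> //; apply/andP; split; last first.
  by apply/(orientation_preserving_seqP e) => i j; rewrite /descent.
apply/existsP; exists 1%g; rewrite odd_perm1 /=; apply/eqP/ffunP => i.
by rewrite !ffunE inE.
Qed.

Lemma card_AOP_ranks : #|AOP n| = \sum_(0 <= k < n.+1) #|rank_part k|.
Proof.
rewrite -sum1_card.
rewrite (partition_big (fun a => inord #|pdom a| : 'I_n.+1) xpredT) //=.
rewrite big_mkord; apply: eq_bigr => k _; rewrite sum1dep_card.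
apply: eq_card => a; rewrite !inE; congr (_ && _).
by rewrite -val_eqE /= inordK // ltnS -[X in _ <= X]card_ord max_card.
Qed.

Lemma card_rank_part_small k :
  k.+3 <= n -> #|rank_part k.+1| = 'C(n, k.+1) ^ 2 * k.+1.
Proof.
move=> lek; rewrite card_rank_part -card_triples; apply: eq_card => u.
by rewrite inE; case: (boolP (u \in _)) => //= uT; rewrite has_parity_small.
Qed.

Lemma card_rank_part_pred k : n = k.+2 -> 2 * #|rank_part k.+1| = n ^ 2 * k.+1.
Proof.
move=> nk; rewrite card_rank_part.
have binn : 'C(n, k.+1) = n by rewrite nk binSn.
have [on|en] := boolP (odd n).
  (* For odd [n] the rank [n - 1] is even, so rotation changes the sign; for even [n] it does not,
     and [toggle] is used instead. *)
  by rewrite card_even_rotate ?binn //; move: on; rewrite nk /= negbK.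
by rewrite card_even_toggle ?binn.
Qed.

End Counting.

Lemma sum_bin_sqr_mul n :
  2 * \sum_(0 <= k < n.+1) 'C(n, k) ^ 2 * k = n * 'C(2 * n, n).
Proof.
(* One of two copies of the sum is reversed, so the weights [k] and [n - k] add up to the constant
   [n]. *)
rewrite mul2n -addnn {2}big_nat_rev /= -big_split /= mul2n -addnn.
rewrite -binomial.Vandermonde big_mkord big_distrr /=; apply: eq_bigr => k _.
have lek : k <= n by rewrite -ltnS.
rewrite add0n subSS bin_sub // -mulnDr subnKC //; lia.
Qed.

Lemma card_rank_part_full n :
  2 * #|rank_part n.+1 n.+1| = if odd n then n.+1 else 2 * n.+1.
Proof.
rewrite card_rank_part; case: ifP => on.
  by rewrite card_even_rotate // binn mul1n.
congr (2 * _); transitivity #|triples n.+1 n.+1|; last first.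
  by rewrite card_triples binn mul1n.
apply: eq_card => u; rewrite inE; case: (boolP (u \in _)) => //= uT.
by rewrite has_parity_full //= on.
Qed.

(** The formula is doubled and freed of subtractions to stay in the natural numbers. The final 2 is
    twice the empty map, which the binomial sum does not count. *)
Lemma card_AOP n : 3 <= n ->
  2 * #|AOP n| + n ^ 2 * n.-1 + (if odd n then 0 else n) = n * 'C(2 * n, n) + 2.
Proof.
case: n => [|[|[|m]]] // _; set n := m.+3.
rewrite -sum_bin_sqr_mul card_AOP_ranks.
(* Rank 0 and the two top ranks are split off; the sums agree term by term on ranks 1 to [n - 2]. *)
rewrite big_nat_recl // [in RHS]big_nat_recl // card_rank_part0 muln0 add0n.
rewrite !big_nat_recr //=.
rewrite (card_rank_part_small (leqnn n)).
have -> : \sum_(0 <= i < m) #|rank_part n i.+1| =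
          \sum_(0 <= i < m) 'C(n, i.+1) ^ 2 * i.+1.
  rewrite !big_mkord; apply: eq_bigr => i _; apply: card_rank_part_small.
  by rewrite !ltnS ltnW.
have := card_rank_part_pred (erefl n); have := card_rank_part_full m.+2.
rewrite binn binSn exp1n mul1n /= -/n.
move: (n ^ 2 * _) #|rank_part n n| #|rank_part n m.+2| => x y z.
by case: (odd m) => /= e1 e2; lia.
Qed.

Local Open Scope ring_scope.

Theorem proposition1p4 (n : nat) (hn : (3 <= n)%N) :
  (#|AOP n|)%:R =
    (if odd n then
       n%:R / 2 * ('C(2 * n, n))%:R - n%:R ^+ 2 * (n%:R - 1) / 2 + 1
     else
       n%:R / 2 * ('C(2 * n, n))%:R
         - (n%:R ^+ 2 * (n%:R - 1) + n%:R) / 2 + 1) :> rat.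
Proof.
have /(congr1 (fun k => k%:R : rat)) := card_AOP hn.
rewrite !natrD !natrM.
(* The truncated predecessor becomes a true difference because [n] is positive. *)
have -> : n.-1%:R = n%:R - 1 :> rat.
  by rewrite -subn1 natrB //; apply: leq_trans hn.
by case: ifP => _ e; lra.
Qed.
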